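(* There exists an absolute constant $c>0$ such that for any prompt $x\in\mathcal X$ and comparator policy $\pi^\star$, if $N\ge\mathcal C_\infty^{\pi^\star}(x)$, the Best-of-$N$ policy $\hat\pi_{\mathtt{BoN}}$ satisfies $$J(\pi^\star;x)-J(\hat\pi_{\mathtt{BoN}};x)\le c\left(R_{\max}\cdot\exp\Big(-\frac{N}{\mathcal C_\infty^{\pi^\star}(x)}\Big)+\sqrt{N\cdot\varepsilon_{\mathtt{RM}}^2(x)}\right).$$ In particular, when $\varepsilon_{\mathtt{RM}}(x)>0$, for any sufficiently large absolute constants $C_1\le C_2$ there is an absolute constant $c'$ such that, as long as $C_1T\le N\le C_2T$ with $T=\mathcal C_\infty^{\pi^\star}(x)\log\big(R_{\max}/\varepsilon_{\mathtt{RM}}(x)\big)$, $$J(\pi^\star;x)-J(\hat\pi_{\mathtt{BoN}};x)\le c'\sqrt{\mathcal C_\infty^{\pi^\star}(x)\cdot\varepsilon_{\mathtt{RM}}^2(x)\cdot\log\big(R_{\max}/\varepsilon_{\mathtt{RM}}(x)\big)}.$$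
   Context: $\mathcal X$ is a set of prompts and $\mathcal Y$ a discrete set of responses. A policy is a map $\pi:\mathcal X\to\Delta(\mathcal Y)$, $x\mapsto\pi(\cdot\mid x)$; $\pi_{\mathsf{ref}}$ is a fixed base policy. The true reward $r^\star$ and reward model $\hat r$ are functions $\mathcal X\times\mathcal Y\to[0,R_{\max}]$, $R_{\max}\ge1$. Write $J(\pi;x)=\mathbb E_{y\sim\pi(\cdot\mid x)}[r^\star(x,y)]$, $\varepsilon_{\mathtt{RM}}^2(x)=\mathbb E_{y\sim\pi_{\mathsf{ref}}(\cdot\mid x)}[(\hat r(x,y)-r^\star(x,y))^2]$ with $\varepsilon_{\mathtt{RM}}(x)\ge0$ its square root, and $\mathcal C_\infty^{\pi}(x)=\sup_{y\in\mathcal Y}\frac{\pi(y\mid x)}{\pi_{\mathsf{ref}}(y\mid x)}$ (equal to $+\infty$ if $\pi(y\mid x)>0=\pi_{\mathsf{ref}}(y\mid x)$ for some $y$; responses with both probabilities zero are ignored). Best-of-$N$ alignment ($N\ge1$ an integer): given $x$, draw $y_1,\dots,y_N$ i.i.d. from $\pi_{\mathsf{ref}}(\cdot\mid x)$ and return $y_{i^\star}$ with $i^\star\in\arg\max_{i\in[N]}\hat r(x,y_i)$; $\hat\pi_{\mathtt{BoN}}(\cdot\mid x)$ is the distribution of the returned response. *)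

(* Defs.v *)
From HB Require Import structures.
From mathcomp Require Import all_boot all_order all_algebra.
From mathcomp Require Import all_classical all_reals all_analysis.

Set Implicit Arguments.
Unset Strict Implicit.
Unset Printing Implicit Defensive.

Import Order.TTheory GRing.Theory Num.Theory.
Import numFieldNormedType.Exports.

Local Open Scope classical_set_scope.
Local Open Scope ring_scope.

Record dist (R : realType) (T : choiceType) := Dist {
  pmf :> T -> R;
  pmf_ge0 : forall t, 0 <= pmf t;
  pmf_sum1 : (\esum_(t in [set: T]) (pmf t)%:E = 1)%E }.

(* [esum] is the unordered sum of a nonnegative family, so [expect p f] is the
   expectation of [f] only for [f] nonnegative, and ([fine]) with a finite
   expectation; it is only used for nonnegative bounded [f]. *)
Definition expect (R : realType) (T : choiceType) (p : dist R T) (f : T -> R)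
    : R :=
  fine (\esum_(t in [set: T]) (p t * f t)%:E).

Section Combinators.
Variable R : realType.

Lemma esum_mull (T : choiceType) (c : R) (a : T -> \bar R) :
  0 <= c -> (forall t, 0 <= a t)%E ->
  (\esum_(t in [set: T]) (c%:E * a t) = c%:E * \esum_(t in [set: T]) a t)%E.
Proof.
move=> c0 a0.
have half (d : R) (b : T -> \bar R) : 0 <= d -> (forall t, 0 <= b t)%E ->
    (\esum_(t in [set: T]) (d%:E * b t) <= d%:E * \esum_(t in [set: T]) b t)%E.
  move=> d0 b0; apply: ge_ereal_sup => _ /= [F [finF _] <-].
  rewrite -ge0_mule_fsumr//; apply: lee_wpmul2l; first by rewrite lee_fin.
  by apply: esum_ge; exists F.
apply/eqP; rewrite eq_le half//=.
have [->|cn0] := eqVneq c 0.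
  by rewrite mul0e; apply: esum_ge0 => t _; rewrite mul0e.
have cp : 0 < c by rewrite lt_neqAle eq_sym cn0.
rewrite muleC -lee_pdivlMr// muleC.
apply: le_trans (half c^-1 (fun t => c%:E * a t)%E _ _); last 2 first.
- by rewrite invr_ge0.
- by move=> t; rewrite mule_ge0 ?lee_fin.
rewrite le_eqVlt; apply/orP; left; apply/eqP; apply: eq_esum => t _.
by rewrite muleA -EFinM mulVf// mul1e.
Qed.

Lemma pmf_le1 (T : choiceType) (p : dist R T) t : p t <= 1.
Proof.
rewrite -lee_fin -(pmf_sum1 p) -(@esum_set1 R T t (fun t => (p t)%:E));
  last by rewrite lee_fin pmf_ge0.
rewrite [leLHS]esum_mkcond; apply: le_esum => i _.
by case: ifP => // _; rewrite lee_fin pmf_ge0.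
Qed.

Section Ret.
Variables (T : choiceType) (a : T).

Definition dret_pmf (t : T) : R := (t == a)%:R.

Fact dret_ge0 t : 0 <= dret_pmf t. Proof. exact: ler0n. Qed.

Fact dret_sum1 : (\esum_(t in [set: T]) (dret_pmf t)%:E = 1)%E.
Proof.
rewrite -[RHS](@esum_set1 R T a (fun=> 1%E))// [RHS]esum_mkcond.
apply: eq_esum => t _; rewrite /dret_pmf; case: eqP => [->|ta].
  by rewrite mem_set.
by rewrite memNset.
Qed.

Definition dret : dist R T := Dist dret_ge0 dret_sum1.
End Ret.

Section Bind.
Variables (S T : choiceType) (p : dist R S) (k : S -> dist R T).

Definition dbind_pmf (t : T) : R := expect p (fun s => k s t).

Let term_ge0 s t : (0 <= (p s * k s t)%:E)%E.
Proof. by rewrite lee_fin mulr_ge0 ?pmf_ge0. Qed.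

Fact dbind_ge0 t : 0 <= dbind_pmf t.
Proof. by apply/fine_ge0/esum_ge0. Qed.

Lemma dbind_pmfE t :
  ((dbind_pmf t)%:E = \esum_(s in [set: S]) (p s * k s t)%:E)%E.
Proof.
rewrite /dbind_pmf /expect fineK// ge0_fin_numE; last exact: esum_ge0.
apply: le_lt_trans (ltry 1); rewrite -(pmf_sum1 p); apply: le_esum => s _.
by rewrite lee_fin ler_piMr ?pmf_ge0 ?pmf_le1.
Qed.

Fact dbind_sum1 : (\esum_(t in [set: T]) (dbind_pmf t)%:E = 1)%E.
Proof.
under eq_esum do rewrite dbind_pmfE.
rewrite esum_esum//.
rewrite (reindex_esum ([set: S] `*`` (fun=> [set: T])) _ (fun x => (x.2, x.1)));
  last first.
  split=> //=; first by move=> [s1 t1] [s2 t2] /= _ _ [] -> ->.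
  by move=> [t s] _ /=; exists (s, t).
rewrite -(@esum_esum _ _ _ setT (fun=> setT) (fun s t => (p s * k s t)%:E))//.
rewrite -(pmf_sum1 p); apply: eq_esum => s _.
under eq_esum do rewrite EFinM.
by rewrite esum_mull ?pmf_ge0// ?pmf_sum1 ?mule1// => t; rewrite lee_fin pmf_ge0.
Qed.

Definition dbind : dist R T := Dist dbind_ge0 dbind_sum1.
End Bind.

Section Iid.
Variables (T : choiceType) (p : dist R T) (n : nat).

Definition iid_pmf (t : n.-tuple T) : R := \prod_(i < n) p (tnth t i).

Fact iid_ge0 t : 0 <= iid_pmf t.
Proof. by apply: prodr_ge0 => i _; exact: pmf_ge0. Qed.
End Iid.

Fact iid_sum1 (T : choiceType) (p : dist R T) n :
  (\esum_(t in [set: n.-tuple T]) (iid_pmf p t)%:E = 1)%E.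
Proof.
elim: n => [|n IHn].
  rewrite (_ : [set: 0.-tuple T] = [set [tuple]]); last first.
    by apply/seteqP; split=> // t _ /=; rewrite tuple0.
  by rewrite esum_set1 /iid_pmf big_ord0.
rewrite (reindex_esum ([set: T] `*`` (fun=> [set: n.-tuple T])) _
          (fun x => cons_tuple x.1 x.2)); last first.
  split=> //=.
    by move=> [a s] [b t] /= _ _ /(congr1 val)[-> /val_inj ->].
  move=> t _; exists (thead t, behead_tuple t) => //=.
  by apply: val_inj; rewrite /= [in RHS](tuple_eta t).
rewrite -(@esum_esum _ _ _ setT (fun=> setT)
  (fun a t => (iid_pmf p (cons_tuple a t))%:E)); last first.
  by move=> *; rewrite lee_fin iid_ge0.
rewrite -(pmf_sum1 p); apply: eq_esum => a _.
rewrite -[RHS]mule1 -IHn -esum_mull ?pmf_ge0//; last first.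
  by move=> t; rewrite lee_fin iid_ge0.
apply: eq_esum => t _; rewrite /iid_pmf big_ord_recl EFinM; congr (_ * _)%E.
by congr EFin; apply: eq_bigr => i _; rewrite tnthS.
Qed.

Definition iid (T : choiceType) (p : dist R T) n : dist R (n.-tuple T) :=
  Dist (@iid_ge0 T p n) (iid_sum1 p n).

End Combinators.

Definition policy (R : realType) (X : Type) (Y : choiceType) := X -> dist R Y.

Section Alignment.
Variables (R : realType) (X : Type) (Y : choiceType).

Definition bounded_reward (Rmax : R) (r : X -> Y -> R) :=
  forall x y, 0 <= r x y <= Rmax.

Definition J (rstar : X -> Y -> R) (pi : policy R X Y) (x : X) : R :=
  expect (pi x) (rstar x).

Definition eps2_RM (piref : policy R X Y) (rstar rhat : X -> Y -> R) (x : X)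
    : R :=
  expect (piref x) (fun y => (rhat x y - rstar x y) ^+ 2).

Definition eps_RM (piref : policy R X Y) (rstar rhat : X -> Y -> R) (x : X)
    : R :=
  Num.sqrt (eps2_RM piref rstar rhat x).

(* In [\bar R], [0^-1 = +oo], so the ratio is [+oo] when
   [pi x y > 0 = piref x y]. *)
Definition Cinf (piref pi : policy R X Y) (x : X) : \bar R :=
  ereal_sup [set ((pi x y)%:E / (piref x y)%:E)%E |
             y in [set y | (pi x y != 0) || (piref x y != 0)]].

(* The way ties are broken is left unspecified, and may be randomized: given
   the prompt and the sample, [sel] is any distribution over indices supported
   on the maximizers of the reward model. *)
Definition argmax_selection (N : nat) (rhat : X -> Y -> R)
    (sel : X -> N.-tuple Y -> dist R 'I_N) :=
  forall x t i, 0 < sel x t i ->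
    forall j, rhat x (tnth t j) <= rhat x (tnth t i).

(* This is Best-of-N for [rhat] when [sel] satisfies [argmax_selection rhat]. *)
Definition BoN (N : nat) (piref : policy R X Y)
    (sel : X -> N.-tuple Y -> dist R 'I_N) : policy R X Y :=
  fun x => dbind (iid (piref x) N)
    (fun t => dbind (sel x t) (fun i => dret R (tnth t i))).

End Alignment.

(* Main.v *)
Require Import Defs.
From HB Require Import structures.
From mathcomp Require Import all_boot all_order all_algebra.
From mathcomp Require Import all_classical all_reals all_analysis.
From mathcomp Require Import ring lra.

Import Order.TTheory GRing.Theory Num.Theory.
Import numFieldNormedType.Exports.

Local Open Scope classical_set_scope.
Local Open Scope ring_scope.

(* Write [q] for the comparator, [p] for the base policy, [C] for the coverage
   and [e = |rhat - rstar|]. Up to the errors [E_q e] and [E_BoN e], the regret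
   is measured by [rhat]. As [q <= C p] and [BoN <= N p], Jensen's inequality
   bounds these errors by [sqrt (C eps^2)] and [sqrt (N eps^2)]. In terms of
   [rhat], the maximum of the sample beats rejection sampling from [q] with
   proposal [p], which fails with probability
   [(1 - 1/C)^N <= exp (- N / C)].

   For the second claim, [C0 = 1] makes the exponential term at most [eps], and
   [1 <= N <= C2 T] gives [eps <= sqrt (C2 T) eps]. When [ln (Rmax / eps) <= 1],
   where [N >= C] may fail, the trivial bound [Rmax <= expR 1 * eps] suffices. *)

(** * Expectations of bounded nonnegative functions *)

Lemma esum_exchange (R : realType) (S T : choiceType) (a : S -> T -> \bar R) :
  (forall s t, 0 <= a s t)%E ->
  (\esum_(t in [set: T]) \esum_(s in [set: S]) a s t =
   \esum_(s in [set: S]) \esum_(t in [set: T]) a s t)%E.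
Proof.
move=> a0; rewrite !esum_esum//.
rewrite (reindex_esum ([set: S] `*`` (fun=> [set: T])) _
  (fun x => (x.2, x.1)))//.
split=> //=; first by move=> [s1 t1] [s2 t2] /= _ _ [] -> ->.
by move=> [t s] _ /=; exists (s, t).
Qed.

Section Expectation.
Context {R : realType} {T : choiceType}.
Implicit Types (p q : dist R T) (f g : T -> R) (B C : R).

(** [fine] would turn an infinite sum into 0. The bound [B] keeps the sum finite, so that identities
    can be proved in [\bar R] and brought back to [R] by [EFin_inj]. *)
Lemma expect_EFin p f B : (forall t, 0 <= f t <= B) ->
  ((expect p f)%:E = \esum_(t in [set: T]) (p t * f t)%:E)%E.
Proof.
move=> fB; have ge0 t : (0 <= (p t * f t)%:E)%E.
  by rewrite lee_fin mulr_ge0 ?Defs.pmf_ge0//; case/andP: (fB t).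
rewrite /expect fineK// ge0_fin_numE; last exact: esum_ge0.
(* The sign of [B] is known only once [T] has an element; otherwise the sum is empty. *)
case: (pselect (exists t : T, True)) => [[t0 _]|noT]; last first.
  by rewrite esum1// => t; case: noT; exists t.
have B0 : 0 <= B by case/andP: (fB t0); exact: le_trans.
apply: (@le_lt_trans _ _ (\esum_(t in [set: T]) (B%:E * (p t)%:E))%E).
  apply: le_esum => t _; rewrite -EFinM lee_fin mulrC.
  by rewrite ler_wpM2r ?Defs.pmf_ge0//; case/andP: (fB t).
rewrite esum_mull ?Defs.pmf_sum1 ?mule1 ?ltry// => t.
by rewrite lee_fin Defs.pmf_ge0.
Qed.

Lemma expect_ge0 p f : (forall t, 0 <= f t) -> 0 <= expect p f.
Proof.
move=> f0; apply/fine_ge0/esum_ge0 => t _.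
by rewrite lee_fin mulr_ge0 ?Defs.pmf_ge0.
Qed.

Lemma le_expect p f g B : (forall t, 0 <= f t <= B) -> (forall t, 0 <= g t <= B) ->
  (forall t, 0 < p t -> f t <= g t) -> expect p f <= expect p g.
Proof.
move=> fB gB fg; rewrite -lee_fin (expect_EFin _ _ _ fB) (expect_EFin _ _ _ gB).
apply: le_esum => t _; rewrite lee_fin.
have := Defs.pmf_ge0 p t; rewrite le_eqVlt => /predU1P[<-|pt]; first by rewrite !mul0r.
by rewrite ler_wpM2l ?fg// ltW.
Qed.

Lemma expectD p f g B : (forall t, 0 <= f t <= B) -> (forall t, 0 <= g t <= B) ->
  expect p (fun t => f t + g t) = expect p f + expect p g.
Proof.
move=> fB gB; apply: EFin_inj.
rewrite EFinD (expect_EFin _ _ _ fB) (expect_EFin _ _ _ gB).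
rewrite (@expect_EFin _ _ (B + B)) => [|t]; last first.
  by case/andP: (fB t) => ? ?; case/andP: (gB t) => ? ?; rewrite addr_ge0 ?lerD.
rewrite -esumD => [|t _|t _]; last 2 first.
- by rewrite lee_fin mulr_ge0 ?Defs.pmf_ge0//; case/andP: (fB t).
- by rewrite lee_fin mulr_ge0 ?Defs.pmf_ge0//; case/andP: (gB t).
by apply: eq_esum => t _; rewrite -EFinD mulrDr.
Qed.

Lemma expectZ p f B c : (forall t, 0 <= f t <= B) -> 0 <= c ->
  expect p (fun t => c * f t) = c * expect p f.
Proof.
move=> fB c0; apply: EFin_inj; rewrite EFinM (expect_EFin _ _ _ fB).
rewrite (@expect_EFin _ _ (c * B)) => [|t]; last first.
  by case/andP: (fB t) => ? ?; rewrite mulr_ge0//= ler_wpM2l.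
rewrite -esum_mull// => [|t]; last first.
  by rewrite lee_fin mulr_ge0 ?Defs.pmf_ge0//; case/andP: (fB t).
by apply: eq_esum => t _; rewrite -EFinM mulrCA.
Qed.

Lemma expect_cst p c : 0 <= c -> expect p (fun=> c) = c.
Proof.
move=> c0; apply: EFin_inj.
rewrite (@expect_EFin _ _ c) => [|t]; last by rewrite c0 lexx.
under eq_esum do rewrite mulrC EFinM.
by rewrite esum_mull ?Defs.pmf_sum1 ?mule1// => t; rewrite lee_fin Defs.pmf_ge0.
Qed.

Lemma expect_bounded p f B : 0 <= B -> (forall t, 0 <= f t <= B) ->
  0 <= expect p f <= B.
Proof.
move=> B0 fB; rewrite expect_ge0/=; last by move=> t; case/andP: (fB t).
rewrite -[leRHS](expect_cst p)//; apply: (le_expect _ _ _ _ fB) => t.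
  by rewrite B0 lexx.
by case/andP: (fB t).
Qed.

Lemma expect_dominated p q f B C : 0 <= C -> (forall t, q t <= C * p t) ->
  (forall t, 0 <= f t <= B) -> expect q f <= C * expect p f.
Proof.
move=> C0 qp fB; rewrite -lee_fin EFinM !(expect_EFin _ _ _ fB).
rewrite -esum_mull// => [|t]; last first.
  by rewrite lee_fin mulr_ge0 ?Defs.pmf_ge0//; case/andP: (fB t).
apply: le_esum => t _; rewrite -EFinM lee_fin mulrA ler_wpM2r//.
by case/andP: (fB t).
Qed.

(** Jensen's inequality for the square. The second moment enters through an upper bound [V], so that
    a change-of-measure estimate can be supplied directly. *)
Lemma expect_le_sqrt p f B V : 0 <= B -> (forall t, 0 <= f t <= B) ->
  expect p (fun t => f t ^+ 2) <= V -> expect p f <= Num.sqrt V.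
Proof.
move=> B0 fB fV.
have f2B t : 0 <= f t ^+ 2 <= B ^+ 2.
  by case/andP: (fB t) => ? ?; rewrite sqr_ge0 ler_sqr ?nnegrE.
(* AM-GM, averaged: below, [s] is the mean of [f]. *)
have amgm s : 0 < s -> 2 * s * expect p f <= s ^+ 2 + V.
  (* [K] bounds [s ^+ 2], [f t ^+ 2] and [2 * s * f t] at once, because [expectD] takes a single
     bound for both summands. *)
  move=> s0; pose K := s ^+ 2 + B ^+ 2 + 2 * s * B.
  have sB : 0 <= s * B by rewrite mulr_ge0// ltW.
  have s20 := sqr_ge0 s; have B20 := sqr_ge0 B.
  have f2K t : 0 <= f t ^+ 2 <= K by case/andP: (f2B t) => -> ? /=; rewrite /K; lra.
  have c0 (t : T) : 0 <= s ^+ 2 <= K by rewrite s20/= /K; lra.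
  rewrite -(expectZ _ _ _ _ fB); last by rewrite mulr_ge0// ltW.
  apply: le_trans (lerD (lexx _) fV).
  rewrite -[X in X + _](expect_cst p)// -(expectD _ _ _ _ c0 f2K).
  apply: (@le_expect _ _ _ (K + K)) => t.
  - clear c0; have /andP[f0 fB'] := fB t.
    have : 0 <= s * f t by rewrite mulr_ge0// ltW.
    have : s * f t <= s * B by rewrite ler_wpM2l// ltW.
    move=> sfB sf0; rewrite -mulrA mulr_ge0//= /K; lra.
  - by case/andP: (f2K t) => ? ?; case/andP: (c0 t) => ? ?; rewrite addr_ge0// lerD.
  - by clear c0; move=> _; have := sqr_ge0 (s - f t); lra.
have E0 : 0 <= expect p f by apply: expect_ge0 => t; case/andP: (fB t).
have [->|En0] := eqVneq (expect p f) 0; first exact: sqrtr_ge0.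
have /amgm EV : 0 < expect p f by rewrite lt_neqAle eq_sym En0.
rewrite -[leLHS](ger0_norm E0) -sqrtr_sqr ler_wsqrtr//.
by move: EV; rewrite -mulrA -expr2; lra.
Qed.
End Expectation.

(** * Composition of distributions and i.i.d. samples *)

Section Monad.
Context {R : realType}.

Lemma expect_dret (T : choiceType) (a : T) (f : T -> R) B :
  (forall t, 0 <= f t <= B) -> expect (dret R a) f = f a.
Proof.
move=> fB; apply: EFin_inj; rewrite (expect_EFin _ _ _ fB).
rewrite -(@esum_set1 R T a (fun t => (f t)%:E)); last first.
  by rewrite lee_fin; case/andP: (fB a).
rewrite [RHS]esum_mkcond; apply: eq_esum => t _ /=; rewrite /dret_pmf.
case: eqP => [->|ta]; first by rewrite mem_set// mul1r.
by rewrite memNset// mul0r.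
Qed.

(** The tower rule: the two sums may be exchanged because every term is nonnegative. *)
Lemma expect_dbind (S T : choiceType) (p : dist R S) (k : S -> dist R T)
    (f : T -> R) B : 0 <= B -> (forall t, 0 <= f t <= B) ->
  expect (dbind p k) f = expect p (fun s => expect (k s) f).
Proof.
move=> B0 fB; apply: EFin_inj; rewrite (expect_EFin _ _ _ fB).
rewrite (@expect_EFin _ _ _ _ B) => [|s]; last exact: expect_bounded.
have f0 t : 0 <= f t by case/andP: (fB t).
under eq_esum => t _.
  rewrite /= EFinM muleC dbind_pmfE -esum_mull//; last first.
    by move=> s; rewrite lee_fin mulr_ge0 ?Defs.pmf_ge0.
  over.
rewrite esum_exchange => [|s t]; last first.
  by rewrite mule_ge0 ?lee_fin ?mulr_ge0 ?Defs.pmf_ge0.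
apply: eq_esum => s _; rewrite EFinM (expect_EFin _ _ _ fB).
rewrite -esum_mull ?Defs.pmf_ge0// => [|t]; last first.
  by rewrite lee_fin mulr_ge0 ?Defs.pmf_ge0.
by apply: eq_esum => t _; rewrite -!EFinM mulrC mulrA.
Qed.

(** Splitting off the first draw drives the inductions on the sample size below, for the sum and for
    the maximum. *)
Lemma expect_iidS (T : choiceType) (p : dist R T) n (f : n.+1.-tuple T -> R) B :
  0 <= B -> (forall t, 0 <= f t <= B) ->
  expect (iid p n.+1) f =
  expect p (fun y => expect (iid p n) (fun t => f (cons_tuple y t))).
Proof.
move=> B0 fB; apply: EFin_inj; rewrite (expect_EFin _ _ _ fB).
rewrite (@expect_EFin _ _ _ _ B) => [|y]; last exact: expect_bounded.
have f0 t : 0 <= f t by case/andP: (fB t).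
rewrite (reindex_esum ([set: T] `*`` (fun=> [set: n.-tuple T])) _
          (fun x => cons_tuple x.1 x.2)); last first.
  split=> //=.
    by move=> [a s] [b t] /= _ _ /(congr1 val)[-> /val_inj ->].
  move=> t _; exists (thead t, behead_tuple t) => //=.
  by apply: val_inj; rewrite /= [in RHS](tuple_eta t).
rewrite -(@esum_esum _ _ _ setT (fun=> setT) (fun a t =>
  (iid p n.+1 (cons_tuple a t) * f (cons_tuple a t))%:E)); last first.
  by move=> *; rewrite lee_fin mulr_ge0 ?Defs.pmf_ge0.
apply: eq_esum => y _; rewrite EFinM (@expect_EFin _ _ _ _ B)//.
rewrite -esum_mull ?Defs.pmf_ge0// => [|t]; last first.
  by rewrite lee_fin mulr_ge0 ?Defs.pmf_ge0.
apply: eq_esum => t _; rewrite -EFinM mulrA; congr (_ * _)%:E.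
rewrite /= /iid_pmf big_ord_recl; congr (_ * _).
by apply: eq_bigr => i _; rewrite tnthS.
Qed.

Lemma sum_tuple_bounded (T : choiceType) m (t : m.-tuple T) (g : T -> R) B :
  (forall y, 0 <= g y <= B) -> 0 <= \sum_(y <- t) g y <= m%:R * B.
Proof.
move=> gB; rewrite -[in m%:R](size_tuple t).
elim: (tval t) => [|y s /andP[s0 sB]]; first by rewrite big_nil mul0r lexx.
have /andP[y0 yB] := gB y.
by rewrite big_cons addr_ge0//= -natr1 mulrDl mul1r addrC lerD.
Qed.

Lemma max_tuple_bounded (T : choiceType) m (t : m.-tuple T) (f : T -> R) B :
  0 <= B -> (forall y, 0 <= f y <= B) ->
  0 <= \big[Num.max/0]_(y <- t) f y <= B.
Proof.
move=> B0 fB.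
elim/big_ind : _ => [|x y /andP[x0 xB] /andP[y0 yB]|y _]; rewrite ?lexx//.
by rewrite le_max x0/= ge_max xB yB.
Qed.

Lemma expect_iid_sum (T : choiceType) (p : dist R T) n (g : T -> R) B :
  0 <= B -> (forall t, 0 <= g t <= B) ->
  expect (iid p n) (fun t => \sum_(y <- t) g y) = n%:R * expect p g.
Proof.
move=> B0 gB; have sumB m (t : m.-tuple T) := sum_tuple_bounded _ _ t _ _ gB.
elim: n => [|n IHn].
  rewrite mul0r -[RHS](expect_cst (iid p 0))//; congr expect; apply/funext => t.
  by rewrite tuple0 big_nil.
have nB0 : 0 <= n%:R * B by rewrite mulr_ge0.
have n1B0 : 0 <= n.+1%:R * B by rewrite mulr_ge0.
rewrite (expect_iidS _ _ _ _ _ n1B0)//.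
pose K := n%:R * B + B; have gK y : 0 <= g y <= K.
  by case/andP: (gB y) => -> ? /=; rewrite /K; lra.
transitivity (expect p (fun y => g y + n%:R * expect p g)).
  congr expect; apply/funext => y; rewrite -IHn.
  rewrite -[X in X + _](expect_cst (iid p n)); last by case/andP: (gB y).
  rewrite -(@expectD _ _ _ _ _ K) => [|t|t]; last 2 first.
  - exact: gK.
  - by case/andP: (sumB n t) => -> ? /=; rewrite /K; lra.
  by congr expect; apply/funext => t; rewrite /= big_cons.
have /andP[E0 EB] := expect_bounded p _ _ B0 gB.
have nE0 : 0 <= n%:R * expect p g by rewrite mulr_ge0.
rewrite (@expectD _ _ _ _ _ K)// => [|y]; last first.
  by rewrite nE0/= /K (le_trans (ler_wpM2l _ EB))//; lra.
by rewrite expect_cst// -natr1; ring.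
Qed.

(* Rejection sampling: accept each draw [y] with probability
   [q y / (C * p y)]. The first accepted draw has law [q], none of [n] draws is
   accepted with probability [(1 - C^-1)^n], and the maximum is at least the
   value of the accepted draw. *)
Lemma expect_iid_max_ge (T : choiceType) (p q : dist R T) (C : R) (f : T -> R) B n :
  1 <= C -> (forall t, q t <= C * p t) -> 0 <= B -> (forall t, 0 <= f t <= B) ->
  (1 - (1 - C^-1) ^+ n) * expect q f <=
  expect (iid p n) (fun t => \big[Num.max/0]_(y <- t) f y).
Proof.
move=> C1 qp B0 fB.
have C0 : 0 < C by apply: lt_le_trans C1.
have maxB m (t : m.-tuple T) : 0 <= \big[Num.max/0]_(y <- t) f y <= B.
  exact: max_tuple_bounded.
elim: n => [|n IHn].
  by rewrite expr0 subrr mul0r expect_ge0// => t; case/andP: (maxB _ t).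
rewrite (expect_iidS _ _ _ _ _ B0)//.
set M := expect (iid p n) _ in IHn.
have MB : 0 <= M <= B by apply: expect_bounded => // t; exact: maxB.
(* Where [p y = 0], division by zero makes this acceptance probability 0. *)
pose a y := q y / (C * p y).
have a01 y : 0 <= a y <= 1.
  rewrite /a divr_ge0 ?mulr_ge0 ?Defs.pmf_ge0//=; last exact: ltW.
  have := Defs.pmf_ge0 p y; rewrite le_eqVlt => /predU1P[<-|py].
    by rewrite mulr0 invr0 mulr0.
  by rewrite ler_pdivrMr ?mul1r// mulr_gt0.
(* Weighting by [a] turns the law [p] into [q / C]. Where [p y = 0] this still holds, since
   domination forces [q y = 0]. *)
have pa (g : T -> R) D : (forall t, 0 <= g t <= D) ->
    expect p (fun y => a y * g y) = C^-1 * expect q g.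
  move=> gD; apply: EFin_inj; rewrite EFinM (expect_EFin _ _ _ gD).
  rewrite (@expect_EFin _ _ _ _ D) => [|y]; last first.
    have /andP[a0 a1] := a01 y; have /andP[g0 gB] := gD y.
    by rewrite mulr_ge0//= (le_trans _ gB)// ler_piMl.
  rewrite -esum_mull ?invr_ge0 ?(ltW C0)// => [|t]; last first.
    by rewrite lee_fin mulr_ge0 ?Defs.pmf_ge0//; case/andP: (gD t).
  apply: eq_esum => y _; rewrite -EFinM; congr EFin; rewrite !mulrA.
  congr (_ * _); rewrite /a.
  have := Defs.pmf_ge0 p y; rewrite le_eqVlt => /predU1P[p0|py].
    have -> : q y = 0.
      by apply/le_anti; rewrite Defs.pmf_ge0 andbT (le_trans (qp y))// -p0 mulr0.
    by rewrite !mulr0 mul0r.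
  by field; rewrite !gt_eqF.
have E0 : 0 <= expect q f by apply: expect_ge0 => t; case/andP: (fB t).
(* After one draw [y], the score is [f y] if it is accepted, and otherwise the value [M] of [n]
   fresh draws. *)
have step : C^-1 * expect q f + (1 - C^-1) * M <=
    expect p (fun y => a y * f y + (1 - a y) * M).
  have b01 y : 0 <= 1 - a y <= 1.
    by case/andP: (a01 y) => ? ?; rewrite subr_ge0 gerBl; apply/andP.
  rewrite (@expectD _ _ _ _ _ B) => [|y|y]; last 2 first.
  - have /andP[a0 a1] := a01 y; have /andP[g0 gB] := fB y.
    by rewrite mulr_ge0//= (le_trans _ gB)// ler_piMl.
  - have /andP[a0 a1] := b01 y; have /andP[g0 gB] := MB.
    by rewrite mulr_ge0//= (le_trans _ gB)// ler_piMl.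
  rewrite (pa _ _ fB) lerD2l.
  have -> : expect p (fun y => (1 - a y) * M) = M * expect p (fun y => 1 - a y).
    rewrite -(expectZ _ _ _ _ b01); last by case/andP: MB.
    by congr expect; apply/funext => y; rewrite mulrC.
  rewrite mulrC ler_wpM2l//; first by case/andP: MB.
  have Ea : expect p a = C^-1.
    have /pa : forall t : T, 0 <= (1 : R) <= 1 by rewrite ler01 lexx.
    rewrite (expect_cst q)// mulr1 => <-.
    by congr expect; apply/funext => y; rewrite mulr1.
  have := expectD p _ _ _ a01 b01; rewrite Ea.
  have -> : (fun y => a y + (1 - a y)) = fun=> 1 by apply/funext => y; rewrite addrC subrK.
  by rewrite expect_cst//; lra.
apply: le_trans (le_trans step _).
  (* The success probabilities satisfy [1 - (1 - C^-1) ^+ n.+1 = C^-1 + (1 - C^-1) * (1 - (1 - C^-1)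
     ^+ n)]. *)
  have Ci1 : 0 <= 1 - C^-1 by rewrite subr_ge0 invf_le1.
  have := ler_wpM2l Ci1 IHn; rewrite exprS; move: (_ ^+ n) => z.
  by move: (expect q f) => E; lra.
apply: (@le_expect _ _ _ _ _ B) => y.
- have /andP[a0 a1] := a01 y; have /andP[g0 gB] := fB y; have /andP[M0 M1] := MB.
  have a1' : 0 <= 1 - a y by rewrite subr_ge0.
  have := ler_wpM2l a0 gB; have := ler_wpM2l a1' M1.
  by move=> ? ?; apply/andP; split; [rewrite addr_ge0// mulr_ge0|lra].
- by apply: expect_bounded => // t; exact: (maxB n.+1).
(* [L] is the mean maximum given that the first draw is [y]. It is at least [f y] and at least [M],
   hence at least their convex combination with weights [a y] and [1 - a y]. *)
move=> _; set L := expect _ _.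
have fL : f y <= L.
  rewrite -[leLHS](expect_cst (iid p n)); last by case/andP: (fB y).
  apply: (@le_expect _ _ _ _ _ B) => [t|t|t _]; [exact: fB|exact: maxB|].
  by rewrite /= big_cons le_max lexx.
have ML : M <= L.
  apply: (@le_expect _ _ _ _ _ B) => [t|t|t _]; [exact: maxB|exact: maxB|].
  by rewrite /= big_cons le_max lexx orbT.
have /andP[a0 a1] := a01 y.
have := ler_wpM2l a0 fL.
have : 0 <= 1 - a y by rewrite subr_ge0.
by move=> /ler_wpM2l /(_ _ _ ML); lra.
Qed.
End Monad.

(** * Coverage, the Best-of-N policy and its regret *)

Section BestOfN.
Context {R : realType} {X : Type} {Y : choiceType}.
Implicit Types (piref pi : policy R X Y) (x : X) (f : Y -> R).

(** The supremum of an empty set is [-oo], so some response charged by [pi x] must be exhibited; one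
    exists because the masses sum to 1. *)
Lemma Cinf_ge0 piref pi x : (0 <= Cinf piref pi x)%E.
Proof.
have [y qy] : exists y, pi x y != 0.
  apply: contrapT => /forallNP q0; have := Defs.pmf_sum1 (pi x).
  rewrite esum1 => [|y _]; first by case=> /eqP; rewrite eq_sym oner_eq0.
  by have /negP/negPn/eqP -> := q0 y.
apply: (@le_trans _ _ ((pi x y)%:E / (piref x y)%:E)%E).
  by rewrite mule_ge0 ?inve_ge0 ?lee_fin ?Defs.pmf_ge0.
by apply: ereal_sup_ubound; exists y => //=; rewrite qy.
Qed.

Lemma Cinf_dominates piref pi x C : Cinf piref pi x = C%:E ->
  forall y, pi x y <= C * piref x y.
Proof.
move=> CE y; have C0 : 0 <= C by rewrite -lee_fin -CE Cinf_ge0.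
have := Defs.pmf_ge0 (pi x) y; rewrite le_eqVlt => /predU1P[<-|qy].
  by rewrite mulr_ge0 ?Defs.pmf_ge0.
have : ((pi x y)%:E / (piref x y)%:E <= C%:E)%E.
  by rewrite -CE; apply: ereal_sup_ubound; exists y => //=; rewrite gt_eqF.
(* If [piref x y = 0], the ratio is [+oo], which a finite coverage excludes. *)
have [->|p0] := eqVneq (piref x y) 0; first by rewrite inve0 gt0_muley ?lte_fin.
rewrite inver (negbTE p0) lee_fin ler_pdivrMr//.
by rewrite lt_neqAle eq_sym p0 Defs.pmf_ge0.
Qed.

(** Summing the domination over all responses compares the total masses, 1 on the left and [C] on
    the right. *)
Lemma Cinf_ge1 piref pi x C : Cinf piref pi x = C%:E -> 1 <= C.
Proof.
move=> CE; have C0 : 0 <= C by rewrite -lee_fin -CE Cinf_ge0.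
have b1 (y : Y) : 0 <= (1 : R) <= 1 by rewrite ler01 lexx.
have := expect_dominated (piref x) (pi x) _ _ _ C0 (Cinf_dominates _ _ _ _ CE) b1.
by rewrite !expect_cst// mulr1.
Qed.

Lemma expect_BoN N piref (sel : X -> N.-tuple Y -> dist R 'I_N) x f B :
  0 <= B -> (forall y, 0 <= f y <= B) ->
  expect (BoN piref sel x) f =
  expect (iid (piref x) N) (fun t => expect (sel x t) (fun i => f (tnth t i))).
Proof.
move=> B0 fB; rewrite (expect_dbind _ _ _ _ _ _ B0 fB).
congr expect; apply/funext => t; rewrite (expect_dbind _ _ _ _ _ _ B0 fB).
by congr expect; apply/funext => i; exact: expect_dret fB.
Qed.

(** Integrated form of the domination of Best-of-N by [N] times [piref]: the value of [f] at the
    selected index is at most its sum over the sample, whose mean is [N] times the mean under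
    [piref]. *)
Lemma expect_BoN_le N piref (sel : X -> N.-tuple Y -> dist R 'I_N) x f B :
  0 <= B -> (forall y, 0 <= f y <= B) ->
  expect (BoN piref sel x) f <= N%:R * expect (piref x) f.
Proof.
move=> B0 fB; rewrite (expect_BoN _ _ _ _ _ _ B0 fB).
rewrite -(expect_iid_sum _ _ _ _ _ B0 fB).
have NB0 : 0 <= N%:R * B by rewrite mulr_ge0.
have fs (t : N.-tuple Y) := sum_tuple_bounded _ _ t _ _ fB.
apply: (@le_expect _ _ _ _ _ (N%:R * B + B)) => t.
- have /andP[-> EB] : 0 <= expect (sel x t) (fun i => f (tnth t i)) <= B.
    by apply: expect_bounded => // i; exact: fB.
  by rewrite (le_trans EB)// lerDr.
- by case/andP: (fs t) => -> /le_trans ->//; rewrite lerDl.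
move=> _; have /andP[s0 sB] := fs t.
rewrite -(expect_cst (sel x t) _ s0); apply: (@le_expect _ _ _ _ _ (N%:R * B + B)) => i.
- by case/andP: (fB (tnth t i)) => -> /le_trans ->//; rewrite lerDr.
- by rewrite s0 (le_trans sB)// lerDl.
move=> _; rewrite big_tuple (bigD1 i)//= lerDl sumr_ge0// => j _.
by case/andP: (fB (tnth t j)).
Qed.

(** The selection charges only maximizers of [rhat], so the returned response attains the sample
    maximum. Starting the maximum from 0 is harmless because [rhat] is nonnegative. *)
Lemma expect_BoN_ge_max N piref (sel : X -> N.-tuple Y -> dist R 'I_N)
    (rhat : X -> Y -> R) x B :
  0 <= B -> (forall y, 0 <= rhat x y <= B) -> argmax_selection rhat sel ->
  expect (iid (piref x) N) (fun t => \big[Num.max/0]_(y <- t) rhat x y) <=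
  expect (BoN piref sel x) (rhat x).
Proof.
move=> B0 fB selP; rewrite (expect_BoN _ _ _ _ _ _ B0 fB).
have maxB (t : N.-tuple Y) : 0 <= \big[Num.max/0]_(y <- t) rhat x y <= B.
  exact: max_tuple_bounded.
apply: (@le_expect _ _ _ _ _ B) => t; first exact: maxB.
  by apply: expect_bounded => // i; exact: fB.
move=> _; rewrite -[leLHS](expect_cst (sel x t)); last by case/andP: (maxB t).
apply: (@le_expect _ _ _ _ _ B) => i; [exact: maxB|exact: fB|move=> si].
rewrite big_tuple; elim/big_ind: _ => [|u v ui vi|j _].
- by case/andP: (fB (tnth t i)).
- by rewrite ge_max ui vi.
- exact: selP.
Qed.

(** The two square roots are kept apart because each claim absorbs the first one differently:
    through [C <= N], or through a bound by the target rate. *)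
Lemma BoN_regret N piref (sel : X -> N.-tuple Y -> dist R 'I_N)
    (rstar rhat : X -> Y -> R) Rmax x pi C :
  0 <= Rmax -> bounded_reward Rmax rstar -> bounded_reward Rmax rhat ->
  argmax_selection rhat sel -> Cinf piref pi x = C%:E ->
  J rstar pi x - J rstar (BoN piref sel) x <=
  Rmax * expR (- (N%:R / C)) +
  (Num.sqrt (C * eps2_RM piref rstar rhat x) +
   Num.sqrt (N%:R * eps2_RM piref rstar rhat x)).
Proof.
move=> B0 /(_ x) rB /(_ x) fB selP CE.
have C1 := Cinf_ge1 _ _ _ _ CE; have dom := Cinf_dominates _ _ _ _ CE.
have C0 : 0 <= C by apply: le_trans C1.
pose e y := `|rhat x y - rstar x y|.
have eB y : 0 <= e y <= Rmax.
  have /andP[? ?] := rB y; have /andP[? ?] := fB y.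
  by rewrite normr_ge0/= ler_norml; apply/andP; split; lra.
have e2B y : 0 <= e y ^+ 2 <= Rmax ^+ 2.
  by case/andP: (eB y) => ? ?; rewrite sqr_ge0 ler_sqr ?nnegrE.
have R20 : 0 <= Rmax ^+ 2 by exact: sqr_ge0.
have e2E : expect (piref x) (fun y => e y ^+ 2) = eps2_RM piref rstar rhat x.
  by congr expect; apply/funext => y; rewrite /e real_normK ?num_real.
(* Used in both directions: from [rstar] to [rhat] under the comparator, and from [rhat] back to
   [rstar] under Best-of-N. *)
have err (p : dist R Y) g h : (forall y, 0 <= g y <= Rmax) ->
    (forall y, 0 <= h y <= Rmax) -> (forall y, g y <= h y + e y) ->
    expect p g <= expect p h + expect p e.
  move=> gB hB ghe; rewrite -(expectD _ _ _ _ hB eB).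
  apply: (@le_expect _ _ _ _ _ (Rmax + Rmax)) => // y.
  - by case/andP: (gB y) => -> /le_trans ->//; rewrite lerDl.
  - by case/andP: (hB y) => ? ?; case/andP: (eB y) => ? ?; rewrite addr_ge0// lerD.
have err_pi : expect (pi x) (rstar x) <= expect (pi x) (rhat x) + expect (pi x) e.
  by apply: err => // y; rewrite -lerBlDl /e distrC ler_norm.
have err_BoN : expect (BoN piref sel x) (rhat x) <=
    expect (BoN piref sel x) (rstar x) + expect (BoN piref sel x) e.
  by apply: err => // y; rewrite -lerBlDl ler_norm.
have e_pi : expect (pi x) e <= Num.sqrt (C * eps2_RM piref rstar rhat x).
  apply: (expect_le_sqrt _ _ _ _ B0 eB); rewrite -e2E.
  exact: (expect_dominated _ _ _ _ _ C0 dom e2B).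
have e_BoN : expect (BoN piref sel x) e <=
    Num.sqrt (N%:R * eps2_RM piref rstar rhat x).
  apply: (expect_le_sqrt _ _ _ _ B0 eB); rewrite -e2E.
  exact: (expect_BoN_le _ _ _ _ _ _ R20 e2B).
have max_BoN := expect_BoN_ge_max _ piref _ _ _ _ B0 fB selP.
have rej := expect_iid_max_ge _ (piref x) (pi x) _ _ _ N C1 dom B0 fB.
(* Raise [1 - C^-1 <= expR (- C^-1)] to the power [N], and bound the mean of [rhat] by [Rmax]. *)
have tail : (1 - C^-1) ^+ N * expect (pi x) (rhat x) <= Rmax * expR (- (N%:R / C)).
  have Ci1 : 0 <= 1 - C^-1 by rewrite subr_ge0 invf_le1// (lt_le_trans _ C1).
  have /andP[E0 EB] := expect_bounded (pi x) _ _ B0 fB.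
  rewrite mulrC ler_pM// ?exprn_ge0//.
  rewrite -mulrN expRM_natl; apply: lerXn2r; rewrite ?nnegrE ?expR_ge0//.
  exact: expR_ge1Dx.
rewrite /J; move: rej; rewrite mulrBl mul1r; lra.
Qed.

Lemma J_regret_le N piref (sel : X -> N.-tuple Y -> dist R 'I_N)
    (rstar : X -> Y -> R) Rmax x pi :
  0 <= Rmax -> bounded_reward Rmax rstar ->
  J rstar pi x - J rstar (BoN piref sel) x <= Rmax.
Proof.
move=> B0 /(_ x) rB; rewrite /J.
have /andP[_ ?] := expect_bounded (pi x) _ _ B0 rB.
have /andP[? _] := expect_bounded (BoN piref sel x) _ _ B0 rB.
lra.
Qed.
End BestOfN.

(** * Assembly of the two claims with explicit constants *)

Theorem theorem3p4 (R : realType) :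
  (exists c : R, 0 < c /\
    forall (X : Type) (Y : choiceType) (Rmax : R) (rstar rhat : X -> Y -> R)
      (piref : policy R X Y) (N : nat) (sel : X -> N.-tuple Y -> dist R 'I_N),
    1 <= Rmax ->
    bounded_reward Rmax rstar -> bounded_reward Rmax rhat ->
    (1 <= N)%N ->
    argmax_selection rhat sel ->
    forall (x : X) (pistar : policy R X Y),
    (Cinf piref pistar x <= N%:R%:E)%E ->
    J rstar pistar x - J rstar (BoN piref sel) x <=
      c * (Rmax * expR (- (N%:R / fine (Cinf piref pistar x))) +
           Num.sqrt (N%:R * eps2_RM piref rstar rhat x)))
  /\
  (exists C0 : R, 0 < C0 /\
    forall C1 C2 : R, C0 <= C1 -> C1 <= C2 ->
    exists c' : R, 0 < c' /\
    forall (X : Type) (Y : choiceType) (Rmax : R) (rstar rhat : X -> Y -> R)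
      (piref : policy R X Y) (N : nat) (sel : X -> N.-tuple Y -> dist R 'I_N),
    1 <= Rmax ->
    bounded_reward Rmax rstar -> bounded_reward Rmax rhat ->
    (1 <= N)%N ->
    argmax_selection rhat sel ->
    forall (x : X) (pistar : policy R X Y),
    let eps := eps_RM piref rstar rhat x in
    let T := (Cinf piref pistar x * (ln (Rmax / eps))%:E)%E in
    0 < eps ->
    (C1%:E * T <= N%:R%:E)%E -> (N%:R%:E <= C2%:E * T)%E ->
    J rstar pistar x - J rstar (BoN piref sel) x <=
      c' * Num.sqrt (fine (Cinf piref pistar x) *
                     eps2_RM piref rstar rhat x * ln (Rmax / eps))).
Proof.
split.
  (* As [C <= N], the comparator's error is at most the Best-of-N error, so the square root is
     counted twice. *)
  exists 2; split => // X Y Rmax rstar rhat piref N sel R1 rB fB _ selP x pistar.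
  have R0 : 0 <= Rmax by apply: le_trans R1.
  case CE : (Cinf piref pistar x) => [C| |] CN; last 2 first.
  - by move: CN; rewrite leye_eq.
  - by have := Cinf_ge0 piref pistar x; rewrite CE leeNy_eq.
  have V0 : 0 <= eps2_RM piref rstar rhat x.
    by apply: expect_ge0 => y; exact: sqr_ge0.
  have := BoN_regret _ _ _ _ _ _ _ _ _ R0 rB fB selP CE.
  have : Num.sqrt (C * eps2_RM piref rstar rhat x) <=
         Num.sqrt (N%:R * eps2_RM piref rstar rhat x).
    by rewrite ler_wsqrtr// ler_wpM2r// -lee_fin.
  have : 0 <= Rmax * expR (- (N%:R / C)) by rewrite mulr_ge0 ?expR_ge0.
  by rewrite /=; lra.
exists 1; split => // C1 C2 C11 C12.
have C20 : 0 < C2 by lra.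
(* The 3 counts the terms of [BoN_regret], each at most [Num.sqrt C2] times the target square root;
   [expR 1] pays for the case where the logarithm is at most 1. *)
exists (3 * Num.sqrt C2 * expR 1); split.
  by rewrite !mulr_gt0 ?sqrtr_gt0 ?expR_gt0.
move=> X Y Rmax rstar rhat piref N sel R1 rB fB N1 selP x pistar eps T eps0.
have R0 : 0 < Rmax by lra.
have N1R : 1 <= N%:R :> R by rewrite ler1n.
have V0 : 0 <= eps2_RM piref rstar rhat x.
  by apply: expect_ge0 => y; exact: sqr_ge0.
have VE : eps2_RM piref rstar rhat x = eps ^+ 2 by rewrite /eps sqr_sqrtr.
have Cge0 := Cinf_ge0 piref pistar x.
rewrite /T; set L := ln (Rmax / eps) => TN NT.
(* If [L <= 0], then [N <= C2 * T <= 0], against [1 <= N]. Working in [\bar R] covers infinite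
   coverage as well. *)
have L0 : 0 < L.
  rewrite ltNge; apply/negP => Lle.
  have : (C2%:E * (Cinf piref pistar x * L%:E) <= 0)%E.
    by apply: mule_ge0_le0; [rewrite lee_fin ltW|exact: mule_ge0_le0].
  by move=> /(le_trans NT); rewrite lee_fin; lra.
have LE : Rmax = eps * expR L.
  by rewrite /L lnK ?posrE ?divr_gt0// mulrC divfK// gt_eqF.
case CE : (Cinf piref pistar x) => [C| |]; last 2 first.
(* Infinite coverage would make [C1 * T] infinite, against [C1 * T <= N]. *)
- by move: TN; rewrite CE gt0_mulye ?lte_fin// gt0_muley ?lte_fin ?leye_eq//; lra.
- by move: Cge0; rewrite CE leeNy_eq.
have Cge1 := Cinf_ge1 _ _ _ _ CE.
move: TN NT; rewrite CE -!EFinM !lee_fin => TN NT.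
rewrite [fine _]/= VE; set S := Num.sqrt (_ * L).
(* Applied to [a = 1] for [eps] itself, to [a = N] for the Best-of-N error and to [a = C] for the
   comparator's error. *)
have C2S (a : R) : 0 <= a -> a <= C2 * (C * L) ->
    Num.sqrt (a * eps ^+ 2) <= Num.sqrt C2 * S.
  move=> a0 aC; rewrite /S -sqrtrM ?(ltW C20)// ler_wsqrtr//.
  rewrite (_ : C2 * _ = C2 * (C * L) * eps ^+ 2); last by ring.
  by rewrite ler_wpM2r// sqr_ge0.
have epsS : eps <= Num.sqrt C2 * S.
  have := C2S 1 ler01; rewrite mul1r sqrtr_sqr ger0_norm ?(ltW eps0)//; apply.
  by apply: le_trans NT.
have NS := C2S _ (ler0n _ N) NT.
have e1 : 1 <= expR (1 : R) by rewrite -expR0 ler_expR.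
have S0 : 0 <= Num.sqrt C2 * S by rewrite mulr_ge0 ?sqrtr_ge0.
rewrite (_ : _ * S = 3 * (Num.sqrt C2 * S * expR 1)); last by ring.
have Se : Num.sqrt C2 * S <= Num.sqrt C2 * S * expR 1 by rewrite ler_peMr.
have [L1|L1] := leP L 1.
  apply: le_trans (J_regret_le _ _ _ _ _ _ _ (ltW R0) rB) _.
  have : Rmax <= Num.sqrt C2 * S * expR 1.
    by rewrite LE ler_pM ?expR_ge0 ?(ltW eps0)// ler_expR.
  by lra.
apply: le_trans (BoN_regret _ _ _ _ _ _ _ _ _ (ltW R0) rB fB selP CE) _.
rewrite VE.
have CS : Num.sqrt (C * eps ^+ 2) <= Num.sqrt C2 * S.
  apply: C2S; first by lra.
  have CL : C <= C * L by rewrite ler_peMr ?(ltW L1)//; lra.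
  by apply: le_trans CL _; rewrite ler_peMl ?mulr_ge0 ?(ltW L0)//; lra.
(* As [N / C >= C1 * L >= L], the exponential is at most [expR (- L) = eps / Rmax]. *)
have : Rmax * expR (- (N%:R / C)) <= eps.
  rewrite LE -mulrA -expRD ler_piMr ?(ltW eps0)// -[leRHS]expR0 ler_expR subr_le0.
  have C0 : 0 < C by lra.
  rewrite ler_pdivlMr// mulrC; apply: le_trans TN.
  by rewrite ler_peMl// mulr_ge0 ?ltW.
by lra.
Qed.
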